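(* Let $I\subset\mathbb R$ be a non-degenerate bounded interval. If $g\colon I\to I$ is a continuous function satisfying $$g^3(x)=3g(x)-2x\quad\text{for every }x\in I,$$ then $g(x)=x$ for every $x\in I$.
   Context: For a self-mapping $g\colon I\to I$, $g^n$ denotes the $n$-th iterate of $g$: $g^0=\mathrm{id}_I$ and $g^k=g\circ g^{k-1}$ for all integers $k\ge 1$ (so $g^3=g\circ g\circ g$, not a power of values). A non-degenerate interval is one with more than one point; it may be open, closed, or closed on one side. *)

(* Defs.v *)
From HB Require Import structures.
From mathcomp Require Import all_boot all_order all_algebra.
From mathcomp Require Import all_classical all_reals all_analysis.
Set Implicit Arguments.
Unset Strict Implicit.
Unset Printing Implicit Defensive.
Import Order.TTheory GRing.Theory Num.Theory numFieldNormedType.Exports.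

(* A self-mapping of an interval I is represented by a total function on R that
   maps I into I; its values outside I are irrelevant. Since I may be open,
   closed or half-open, continuity is that of the restriction to I. *)

(* Main.v *)
(* Along an orbit, x_(n+3) = 3 x_(n+1) - 2 x_n, with characteristic polynomial
   (t - 1)^2 (t + 2), so x_n = A + B n + C (-2)^n. A bounded orbit forces
   B = C = 0, so x_1 = x_0. *)
Require Import Defs.
From HB Require Import structures.
From mathcomp Require Import all_boot all_order all_algebra.
From mathcomp Require Import all_classical all_reals all_analysis.
From mathcomp Require Import ring lra.
Set Implicit Arguments.
Unset Strict Implicit.
Unset Printing Implicit Defensive.
Import Order.TTheory GRing.Theory Num.Theory.
Import numFieldNormedType.Exports.
Local Open Scope classical_set_scope.
Local Open Scope ring_scope.

(** The recurrence need not be solved: the second difference of an orbit is multiplied by -2 at each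
    step, so boundedness forces it to vanish. The orbit is then a bounded arithmetic progression,
    whose common difference must be 0. Both vanishings come from the Archimedean property, in the
    form of [natmul_bounded_eq0]. *)

Lemma natmul_bounded_eq0 (R : realType) (a M : R) :
  (forall n : nat, `|a| *+ n <= M) -> a = 0.
Proof.
move=> aM; apply/eqP; rewrite -normr_le0 leNgt; apply/negP => a0.
have := aM (Num.truncn (M / `|a|)).+1.
by rewrite -mulr_natl -ler_pdivlMr// leNgt truncnS_gt.
Qed.

Lemma bounded_linear_recurrence_eq (R : realType) (u : nat -> R) (M : R) :
  (forall n, `|u n| <= M) ->
  (forall n, u n.+3 = 3 * u n.+1 - 2 * u n) ->
  u 1 = u 0.
Proof.
move=> uM uE.
(* The second difference kills A + B n and leaves 9 C (-2)^n. *)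
pose d n := u n.+2 - 2 * u n.+1 + u n.
have dE m n : d (m + n)%N = (- 2) ^+ n * d m.
  elim: n => [|n IHn]; first by rewrite addn0 expr0 mul1r.
  by rewrite addnS exprS -mulrA -IHn /d uE; ring.
have d0 n : d n = 0.
  (* The coefficients 1, -2, 1 give the bound [4 * M]; since [k <= 2 ^ k], geometric growth reduces
     to linear growth. *)
  apply: (@natmul_bounded_eq0 _ _ (4 * M)) => k.
  have dM : `|d (n + k)%N| <= 4 * M.
    have := (uM (n + k)%N, uM (n + k).+1, uM (n + k).+2).
    by rewrite /d !ler_norml => -[[/andP[? ?] /andP[? ?]] /andP[? ?]]; lra.
  apply: le_trans dM; rewrite dE normrM normrX normrN normr_nat.
  rewrite -[leLHS]mulr_natl ler_wpM2r// -natrX ler_nat ltnW//.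
  exact: ltn_expl.
(* The second conjunct, constancy of the first difference, is what [d n = 0] propagates; it drives
   the induction for the first. *)
have uA n : u n = u 0 + (u 1 - u 0) *+ n /\ u n.+1 = u n + (u 1 - u 0).
  elim: n => [|n [IH1 IH2]]; first by rewrite mulr0n addr0 subrKC.
  split; first by rewrite IH2 IH1 -addrA -mulrSr.
  by have := d0 n; rewrite /d => dn0; lra.
apply/subr0_eq/(@natmul_bounded_eq0 _ _ (2 * M)) => n.
have -> : `|u 1 - u 0| *+ n = `|u n - u 0|.
  by rewrite (uA n).1 [u 0 + _]addrC addrK normrMn.
by have := uM n; have := uM 0; rewrite !ler_norml => /andP[? ?] /andP[? ?]; lra.
Qed.

Theorem theorem3p1 (R : realType) (I : set R) (g : R -> R)
    (I_itv : is_interval I)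
    (I_bounded : bounded_set I)
    (I_nondegenerate : exists x y : R, [/\ I x, I y & x <> y])
    (g_self : set_fun I I g)
    (g_cont : {within I, continuous g})
    (g_eq : forall x : R, I x -> iter 3 g x = 3 * g x - 2 * x) :
  forall x : R, I x -> g x = x.
Proof.
move=> x Ix; have [M [_ IM]] := I_bounded.
have Iiter n : I (iter n g x) by elim: n => //= n; exact: g_self.
(* [bounded_set] only provides bounds strictly above [M], hence [M + 1]. *)
apply: (@bounded_linear_recurrence_eq _ (fun n => iter n g x) (M + 1)) => n.
  by apply: IM => //; rewrite ltrDl.
exact: g_eq (Iiter n).
Qed.
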